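(* Let $W$ be a Coxeter group with simple generators $S$, let $w$ be an element of $W$ and let $\Omega$ be an orientation of the Coxeter diagram $\Gamma$ of $W$. Then there is an $\Omega$-acyclic subset $J(w,\Omega)$ of $S$ which is maximal (under inclusion) among those $\Omega$-acyclic subsets $J'$ of $S$ having the property that $w\ge c(\Omega,J')$ in the weak order.
   Context: $W$ is a Coxeter group with finite set $S$ of simple generators; $\ell$ is the length function and $e$ the identity. The (right) weak order on $W$ sets $u\le w$ if and only if $\ell(u)+\ell(u^{-1}w)=\ell(w)$. The Coxeter diagram $\Gamma$ is the graph with vertex set $S$ in which distinct $s,t$ are joined by an edge if and only if they do not commute. $\Omega$ is an arbitrary orientation of $\Gamma$ (each edge is given one direction; directed cycles are allowed). A subset $J\subseteq S$ is $\Omega$-acyclic if the induced subgraph of $\Gamma$ on $J$, oriented by $\Omega$, has no directed cycle. For $\Omega$-acyclic $J$, $c(\Omega,J)=s_1s_2\cdots s_k$, where $s_1,\ldots,s_k$ is any ordering of $J$ such that $i<j$ whenever there is an edge oriented $s_j\to s_i$ (the product does not depend on the ordering; $c(\Omega,\emptyset)=e$). *)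

(* Defs.v *)
From mathcomp Require Import all_boot.

Set Implicit Arguments.
Unset Strict Implicit.
Unset Printing Implicit Defensive.

Local Open Scope group_scope.

Definition word_prod (W : groupType) (S : Type) (g : S -> W) (p : seq S) : W :=
  \prod_(s <- p) g s.

Definition alt_word (S : Type) (s t : S) (k : nat) : seq S :=
  flatten (nseq k [:: s; t]).

(* Congruence on the free monoid over S generated by (s t)^(m s t) ~ e.  When
   m s s = 1 this contains s s ~ e, so the quotient monoid is already the group
   presented by the relations (s t)^(m s t) = e and formal inverses are not
   needed.  The value m s t = 0 encodes infinity: it imposes no relation. *)
Inductive cox_cong (S : Type) (m : S -> S -> nat) : seq S -> seq S -> Prop :=
| cox_rel a b s t : cox_cong m (a ++ alt_word s t (m s t) ++ b) (a ++ b)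
| cox_refl p : cox_cong m p p
| cox_sym p q : cox_cong m p q -> cox_cong m q p
| cox_trans p q r : cox_cong m p q -> cox_cong m q r -> cox_cong m p r.

Record coxeter_system (W : groupType) (S : finType) := CoxeterSystem {
  cox_gen :> S -> W;
  cox_mx : S -> S -> nat;
  cox_gen_inj : injective cox_gen;
  cox_mx_diag : forall s, cox_mx s s = 1%N;
  cox_mx_sym : forall s t, cox_mx s t = cox_mx t s;
  cox_mx_offdiag : forall s t, s != t -> cox_mx s t != 1%N;
  cox_generated : forall w, exists p, word_prod cox_gen p = w;
  cox_presented : forall p q,
    word_prod cox_gen p = word_prod cox_gen q <-> cox_cong cox_mx p q
}.

Lemma cox_length_ex (W : groupType) (S : finType) (g : coxeter_system W S)
    (w : W) :
  exists n, [exists p : n.-tuple S, word_prod g p == w].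
Proof.
have [p <-] := cox_generated g w.
by exists (size p); apply/existsP; exists (in_tuple p).
Qed.

Definition cox_length (W : groupType) (S : finType) (g : coxeter_system W S)
    (w : W) : nat :=
  ex_minn (cox_length_ex g w).

Definition weak_le (W : groupType) (S : finType) (g : coxeter_system W S)
    (u w : W) : bool :=
  (cox_length g u + cox_length g (u^-1 * w) == cox_length g w)%N.

Definition diagram (W : groupType) (S : finType) (g : coxeter_system W S) :
    rel S :=
  fun s t => (s != t) && (g s * g t != g t * g s).

(* orient s t means that the edge joining s and t is directed s -> t. *)
Record orientation (S : finType) (e : rel S) := Orientation {
  orient :> rel S;
  orient_edge : forall s t, orient s t -> e s t;
  orient_one_way : forall s t, e s t -> orient s t (+) orient t s
}.

Definition acyclic (S : finType) (O : rel S) (J : {set S}) : Prop :=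
  forall p : seq S, {subset p <= J} -> ucycle O p -> p = [::].

Definition compatible (S : finType) (O : rel S) (p : seq S) : bool :=
  [forall s in p, forall t in p, O s t ==> (index t p < index s p)%N].

(* The orderings of J are the elements of permutations (enum J); one that is
   compatible exists when J is acyclic (compatible_ex), and all of them have
   the same product (cox_elt_eq).  The value is junk when J is not acyclic. *)
Definition cox_elt (W : groupType) (S : finType) (g : coxeter_system W S)
    (O : orientation (diagram g)) (J : {set S}) : W :=
  word_prod g (head [::] [seq p <- permutations (enum J) | compatible O p]).

Lemma compatible_pairwise (S : finType) (O : rel S) (p : seq S) :
  uniq p -> (forall s, ~~ O s s) ->
  compatible O p = pairwise (fun s t => ~~ O s t) p.
Proof.
move=> Up Oirr; apply/idP/idP.
  move=> /forall_inP C; case: p Up C => // x0 p' Up C.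
  apply/(pairwiseP x0) => i j; rewrite !inE => ip jp ij; apply/negP => Oij.
  have := forall_inP (C _ (mem_nth x0 ip)) _ (mem_nth x0 jp).
  by rewrite Oij implyTb !index_uniq // ltnNge ltnW.
move=> P; apply/forall_inP => s sp; apply/forall_inP => t tp.
apply/implyP => Ost; case: (ltngtP (index t p) (index s p)) => // [lt|eq].
  have := (pairwiseP s P) (index s p) (index t p).
  by rewrite !inE !index_mem sp tp !nth_index // Ost => /(_ isT isT lt).
have E : s = t by rewrite -(nth_index s sp) -eq nth_index.
by move: Ost (Oirr t); rewrite E => ->.
Qed.

Lemma orient_irr (S : finType) (e : rel S) (O : orientation e) s : ~~ O s s.
Proof.
apply/negP => Oss.
by have := orient_one_way O (orient_edge Oss); rewrite Oss.
Qed.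

Lemma acyclic_sink (S : finType) (O : rel S) (J : {set S}) x :
  acyclic O J -> x \in J -> exists2 a, a \in J & {in J, forall b, ~~ O a b}.
Proof.
move=> aJ xJ.
case: (pickP [pred a in J | [forall b in J, ~~ O a b]]) => [a|none].
  by case/andP=> aJ' /forall_inP H; exists a.
pose f a := odflt a [pick b in J | O a b].
have fP a : a \in J -> (f a \in J) && O a (f a).
  move=> aJ'; rewrite /f; case: pickP => [b //|no] /=.
  have /negP[] := none a; rewrite /= aJ' /=.
  by apply/forall_inP => b bJ; move: (no b); rewrite /= bJ /= => ->.
have fJ n a : a \in J -> iter n f a \in J.
  by move=> aJ'; elim: n => //= n IH; case/andP: (fP _ IH).
pose y := iter (order f x) f x.
have yJ : y \in J by exact: fJ.
have /trajectP[i lti yi] : looping f x (order f x) by exact: looping_order.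
have cy : fconnect f (f y) y.
  rewrite {1}/y yi -iterS /y -(subnK lti) iterD.
  exact: fconnect_iter.
have fc : fcycle f (orbit f y) by rewrite -fconnect_f.
have sub : {subset orbit f y <= J}.
  by move=> z; rewrite -fconnect_orbit => /iter_findex <-; exact: fJ.
suff E : orbit f y = [::] by have := in_orbit f y; rewrite E.
apply: aJ => //; rewrite /ucycle orbit_uniq andbT.
apply: (@sub_in_cycle _ (mem J) (frel f)) fc; last by apply/allP.
by move=> a b aJ' _ /eqP <-; case/andP: (fP a aJ').
Qed.

Lemma compatible_ex (S : finType) (O : rel S) (J : {set S}) :
  (forall s, ~~ O s s) -> acyclic O J ->
  exists2 p, perm_eq p (enum J) & compatible O p.
Proof.
move=> Oirr; move En : #|J| => n.
elim: n J En => [|n IH] J En aJ.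
  exists [::]; last by apply/forall_inP.
  by move/eqP: En; rewrite cards_eq0 => /eqP ->; rewrite enum_set0.
have /set0Pn[x xJ] : J != set0 by rewrite -cards_eq0 En.
have [a aJ' sinka] := acyclic_sink aJ xJ.
have [||p pJ Cp] := IH (J :\ a).
- by move: (cardsD1 a J); rewrite aJ' En => -[->].
- by move=> q sq; apply: aJ => z /sq; rewrite inE => /andP[].
have memp z : (z \in p) = (z != a) && (z \in J).
  by rewrite (perm_mem pJ) mem_enum !inE.
have Up : uniq p by rewrite (perm_uniq pJ) enum_uniq.
have Uap : uniq (a :: p) by rewrite /= memp eqxx Up.
exists (a :: p).
  apply: uniq_perm => //; first exact: enum_uniq.
  move=> z; rewrite inE memp mem_enum; case: eqP => // ->.
  by rewrite aJ'.
move: Cp; rewrite !compatible_pairwise //= => ->; rewrite andbT.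
by apply/allP => z; rewrite memp => /andP[_ /sinka].
Qed.

Lemma word_prod_compatible (W : groupType) (S : finType)
    (g : coxeter_system W S) (O : orientation (diagram g)) (p q : seq S) :
  uniq p -> perm_eq p q -> compatible O p -> compatible O q ->
  word_prod g p = word_prod g q.
Proof.
move=> Up pq; have Uq : uniq q by rewrite -(perm_uniq pq).
rewrite !compatible_pairwise //; try exact: orient_irr.
elim: p q Up pq Uq => [|a p IH] q Up pq Uq.
  by move: pq; rewrite perm_sym => /perm_nilP ->.
have aq : a \in q by rewrite -(perm_mem pq) mem_head.
case/splitPr: aq pq Uq => q1 q2 pq Uq /= /andP[/allP Ca Cp] Cq.
have pq' : perm_eq p (q1 ++ q2).
  by rewrite -(perm_cons a) (permPl pq) -[a :: q2]cat1s perm_catCA.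
have Up' : uniq p by case/andP: Up.
have Uq' : uniq (q1 ++ q2) by rewrite -(perm_uniq pq').
have Cq' : pairwise (fun s t => ~~ O s t) (q1 ++ q2).
  move: Cq; apply: subseq_pairwise; apply: cat_subseq => //.
  exact: subseq_cons.
rewrite {1}/word_prod big_cons -/(word_prod g p) (IH _ Up' pq' Uq' Cp Cq').
rewrite /word_prod !big_cat big_cons /= !mulgA; congr (_ * _).
have com b : b \in q1 -> g a * g b = g b * g a.
  move=> bq1; apply/eqP; apply/negPn/negP => ne.
  have ab : a != b by apply: contraNneq ne => ->.
  have e : diagram g a b by rewrite /diagram ab.
  have nab : ~~ O a b by apply: Ca; rewrite (perm_mem pq') mem_cat bq1.
  have nba : ~~ O b a.
    move: Cq; rewrite pairwise_cat => /and3P[/allrelP H _ _].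
    by apply: H => //; rewrite mem_head.
  by have := orient_one_way O e; rewrite (negbTE nab) (negbTE nba).
elim: (q1) com => [|b r IHr] com; first by rewrite big_nil mulg1 mul1g.
rewrite big_cons mulgA com ?mem_head // -!mulgA; congr (_ * _).
by apply: IHr => z zr; apply: com; rewrite inE zr orbT.
Qed.

Lemma cox_elt_eq (W : groupType) (S : finType) (g : coxeter_system W S)
    (O : orientation (diagram g)) (J : {set S}) (p : seq S) :
  perm_eq p (enum J) -> compatible O p -> cox_elt O J = word_prod g p.
Proof.
move=> pJ Cp; rewrite /cox_elt.
set l := [seq _ <- _ | _].
have pl : p \in l by rewrite mem_filter Cp mem_permutations.
have : head [::] l \in l by case: (l) pl => //= x r _; rewrite mem_head.
rewrite mem_filter mem_permutations => /andP[Cq qJ].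
apply: (@word_prod_compatible _ _ g O) => //.
  by rewrite (perm_uniq qJ) enum_uniq.
by rewrite (permPl qJ) perm_sym.
Qed.

Definition acyclic_below (W : groupType) (S : finType)
    (g : coxeter_system W S) (O : orientation (diagram g)) (w : W)
    (J : {set S}) : Prop :=
  acyclic O J /\ weak_le g (cox_elt O J) w.

(* Main.v *)
From HB Require Import structures.
Require Import Defs.
From mathcomp Require Import all_boot all_order all_algebra.
From mathcomp Require Import ring lra.
From mathcomp Require Import Rstruct reals trigo.

Set Implicit Arguments.
Unset Strict Implicit.
Unset Printing Implicit Defensive.

Import Order.TTheory GRing.Theory Num.Theory.

(** Write J <= w for: J is acyclic and c(J) <= w in the weak order.  If J1 <= w
and J2 <= w then J1 :|: J2 <= w [below_setU]; hence the union of all J <= w is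
the greatest of them and the only maximal one.

Closure under union goes by induction on the size of J = J1 :|: J2.  If J has a
sink x, then x is a left descent of w, it can be put first in the ordering of
each Ji that contains it, and both Ji minus x stay below x w; for a Ji without x
this is [weak_le_gen_mul].  So J minus x is below x w, and J is below w.

It remains to see that a nonempty J has a sink [ex_common_sink].  Here W acts on
the space V with basis the simple roots alpha_s, by
  s . v = v - <s, v> alpha_s,   <s, alpha_t> = K s t,   K s s = 2,
and K s t = - om s t * 2 cos (pi / m s t) for s <> t.  The relations of W and
the sign property of roots [rep_root_nonneg] hold for any positive factors om
with om s t * om t s = 1; the choice om = 1 gives the usual symmetric form.
For an ordering of Ji, let beta_x be the image of alpha_x under the letters
before x.  Then Ji <= w says that w^-1 maps each beta_x to a nonpositive vector
[weak_leP], and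
  beta_x = alpha_x + sum over the arrows x -> y in Ji of (- K y x) beta_y.
If J had no sink, a minimal nonempty subset T of J closed under successors in J
would have the property that each of its vertices has both a successor and a
predecessor in T.  The freedom in om is used to set - K y x = 1 / d y for an
arrow x -> y in T, with d y the number of predecessors of y in T; then
- K x y >= 1, because 4 cos^2 (pi / m) >= 1 on an edge.
Consider the sum v of the alpha_x for x in T.
 - For x in T, <x, v> <= 2 - 1 - 1 = 0: the predecessors of x contribute -1 in
   all, and a successor at most -1.  So v is antidominant, and w^-1 v - v is
   nonnegative [rep_antidominant]: the coordinates of w^-1 v have positive sum.
 - Let D u be minus the sum of the coordinates of w^-1 u, and G x the larger of
   the D beta_x for J1 and for J2 (0 where x is missing), so G >= 0.  The
   recurrence for beta_x gives
     G x <= D alpha_x + sum over the arrows x -> y in T of G y / d y.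
   Summed over x in T, the double sum is exactly the sum of the G y, which
   leaves D v >= 0: a contradiction [no_cyclic_cover]. *)

(** * Chebyshev values at 2 cos (pi / m) *)

Section DihedralNumbers.
Local Open Scope ring_scope.

(** With c = 2 cos a this is sin (k a) / sin a. The roots of a rank two
subsystem have these numbers as coordinates, up to scaling. *)
Fixpoint cheb (R : pzRingType) (c : R) (k : nat) : R :=
  if k is k'.+1 then
    if k' is k''.+1 then c * cheb c k' - cheb c k'' else 1
  else 0.

(** What the geometric representation needs to know about c = 2 cos (pi / m);
the value m = 0 stands for infinity, where c = 2. The determinant of the rank
two Cartan matrix is 4 - c ^+ 2. *)
Record dihedral_number (R : realFieldType) (m : nat) (c : R) : Prop := {
  cheb_ge0 : forall k, (m == 0%N) || (k <= m)%N -> 0 <= cheb c k;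
  cheb_double : (0 < m)%N -> cheb c m.*2 = 0;
  cheb_doubleS : (0 < m)%N -> cheb c m.*2.+1 = 1;
  dihedral_det : (0 < m)%N -> c ^+ 2 != 4
}.

Lemma cheb_sin (R : realType) (a : R) (k : nat) :
  cheb (2 * cos a) k * sin a = sin (a *+ k).
Proof.
elim/ltn_ind: k => [[|[|k]] IH]; first by rewrite mul0r mulr0n sin0.
  by rewrite mul1r.
rewrite /= -/(cheb _ k.+1) mulrBl -mulrA IH // IH //.
rewrite (mulrS a k.+1) addrC sinD (mulrS a k) addrC.
rewrite [cos (_ + _)]cosD [sin (_ + _)]sinD.
have := sin2cos2 a; move: (cos a) (sin a) (cos _) (sin _) => x y z t.
by move=> E; ring: E.
Qed.

Definition dihedral_cos (R : realType) (m : nat) : R :=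
  if m == 0%N then 2 else 2 * cos (pi / m%:R).

Lemma dihedral_cosP (R : realType) (m : nat) :
  m != 1%N -> dihedral_number m (dihedral_cos R m).
Proof.
case: m => [_|[//|m _]].
  have E k : cheb (2 : R) k = k%:R.
    elim/ltn_ind: k => [[|[|k]] IH] //.
    by rewrite /= -/(cheb _ k.+1) !IH // -[k.+2]addn2 -[k.+1]addn1 !natrD; ring.
  by split=> // k _; rewrite E ler0n.
rewrite /dihedral_cos /=.
set n := m.+2; set a : R := pi / n%:R.
have na : a *+ n = pi by rewrite -[LHS]mulr_natr divfK // pnatr_eq0.
have a0 : 0 < a by rewrite divr_gt0 ?pi_gt0 ?ltr0n.
have sa : 0 < sin a.
  apply: sin_gt0_pi; by rewrite a0 -na /n mulrS ltrDl pmulrn_lgt0.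
have sa0 : sin a != 0 by rewrite gt_eqF.
have chebE k : cheb (2 * cos a) k = sin (a *+ k) / sin a.
  by rewrite -cheb_sin mulfK.
split=> [k /= kn|_|_|_].
- rewrite chebE divr_ge0 ?(ltW sa) // sin_ge0_pi //.
  by by rewrite -na -(subnKC kn) mulrnDr lerDl !mulrn_wge0 // ltW.
- by rewrite chebE -muln2 mulrnA na sin2pi mul0r.
- by rewrite chebE mulrS -muln2 mulrnA na sinD2pi divff.
- rewrite exprMn cos2sin2; apply/eqP => E.
  have /eqP : sin a ^+ 2 = 0 by lra.
  by rewrite expf_eq0 (negbTE sa0).
Qed.

Lemma chebSS (R : pzRingType) (c : R) (k : nat) :
  cheb c k.+2 = c * cheb c k.+1 - cheb c k.
Proof. by []. Qed.

End DihedralNumbers.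

Arguments cheb : simpl never.

(** * Words and length *)

Section Words.
Local Open Scope group_scope.

Variables (W : groupType) (S : finType) (g : coxeter_system W S).
Local Notation len := (cox_length g).

Lemma word_prod_cons s p : word_prod g (s :: p) = g s * word_prod g p.
Proof. by rewrite /word_prod big_cons. Qed.

Lemma word_prod_cat p q : word_prod g (p ++ q) = word_prod g p * word_prod g q.
Proof. by rewrite /word_prod big_cat. Qed.

Lemma word_prod1 s : word_prod g [:: s] = g s.
Proof. by rewrite /word_prod big_seq1. Qed.

Lemma word_prod_rcons p s : word_prod g (rcons p s) = word_prod g p * g s.
Proof. by rewrite -cats1 word_prod_cat word_prod1. Qed.

Lemma word_prod_alt s t : word_prod g (alt_word s t (cox_mx g s t)) = 1.
Proof.
have := cox_rel (cox_mx g) [::] [::] s t.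
by rewrite cats0 /= => /cox_presented ->; rewrite /word_prod big_nil.
Qed.

Lemma cox_gen_sq s : g s * g s = 1.
Proof.
have := word_prod_alt s s.
by rewrite cox_mx_diag /alt_word /= word_prod_cons word_prod1.
Qed.

Lemma cox_genV s : (g s)^-1 = g s.
Proof. by apply: mulg1_eq; rewrite cox_gen_sq. Qed.

Lemma mulgenK w s : w * g s * g s = w.
Proof. by rewrite -mulgA cox_gen_sq mulg1. Qed.

Lemma word_prod_rev p : word_prod g (rev p) = (word_prod g p)^-1.
Proof.
elim: p => [|s p IH]; first by rewrite /word_prod big_nil invg1.
by rewrite rev_cons word_prod_rcons IH word_prod_cons invgM cox_genV.
Qed.

Lemma cox_length_le p : (len (word_prod g p) <= size p)%N.
Proof.
rewrite /cox_length; case: ex_minnP => n _; apply.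
by apply/existsP; exists (in_tuple p).
Qed.

Lemma reduced_ex w : exists p, (word_prod g p == w) && (size p == len w).
Proof.
rewrite /cox_length; case: ex_minnP => n /existsP[p /eqP <-] _.
by exists p; rewrite size_tuple !eqxx.
Qed.

Definition reduced_word w := xchoose (reduced_ex w).

Lemma reduced_wordK w : word_prod g (reduced_word w) = w.
Proof. by have /andP[/eqP] := xchooseP (reduced_ex w). Qed.

Lemma size_reduced w : size (reduced_word w) = len w.
Proof. by have /andP[_ /eqP] := xchooseP (reduced_ex w). Qed.

Lemma cox_length1 : len 1 = 0%N.
Proof.
by have := cox_length_le [::]; rewrite /word_prod big_nil leqn0 => /eqP.
Qed.

Lemma cox_lengthV w : len w^-1 = len w.
Proof.
have le u : (len u^-1 <= len u)%N.
  rewrite -{1}(reduced_wordK u) -word_prod_rev -(size_reduced u).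
  by rewrite -(size_rev (reduced_word u)) cox_length_le.
by apply/eqP; rewrite eqn_leq le -{1}(invgK w) le.
Qed.

Lemma cox_lengthM u v : (len (u * v) <= len u + len v)%N.
Proof.
rewrite -{1}(reduced_wordK u) -{1}(reduced_wordK v) -word_prod_cat.
by rewrite (leq_trans (cox_length_le _)) // size_cat !size_reduced.
Qed.

Lemma cox_length_gen s : (len (g s) <= 1)%N.
Proof. by rewrite -word_prod1 cox_length_le. Qed.

Lemma cox_length_mulr w s : (len w <= (len (w * g s)).+1)%N.
Proof.
rewrite -{1}(mulgenK w s) (leq_trans (cox_lengthM _ _)) //.
by rewrite -addn1 leq_add2l cox_length_gen.
Qed.

Lemma cox_length_mull w s : (len w <= (len (g s * w)).+1)%N.
Proof.
rewrite -cox_lengthV -(cox_lengthV (_ * w)) invgM cox_genV.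
exact: cox_length_mulr.
Qed.

Lemma cox_length_last w : w != 1 -> exists s, (len w = (len (w * g s)).+1)%N.
Proof.
have := reduced_wordK w; have := size_reduced w.
case/lastP: (reduced_word w) => [_|p s].
  by rewrite /word_prod big_nil => ->; rewrite eqxx.
rewrite size_rcons word_prod_rcons => sz E _; exists s.
apply/eqP; rewrite eqn_leq cox_length_mulr /= -sz -{1}E mulgenK.
exact: cox_length_le.
Qed.

Fixpoint zigzag (s t : S) (k : nat) : seq S :=
  if k is k'.+1 then rcons (zigzag t s k') t else [::].

Lemma zigzagS s t k : 
  zigzag s t k.+1 = (if odd k then s else t) :: zigzag s t k.
Proof.
elim: k s t => [|k IH] s t //.
by rewrite -[LHS]/(rcons (zigzag t s k.+1) t) IH /=; case: (odd k).
Qed.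

Lemma size_zigzag s t k : size (zigzag s t k) = k.
Proof. by elim: k s t => //= k IH s t; rewrite size_rcons IH. Qed.

Lemma alt_word_rcons s t k :
  rcons (alt_word t s k) t = t :: alt_word s t k :> seq S.
Proof. by elim: k => //= k; rewrite /alt_word /= => ->. Qed.

(** Since letters are involutions, this splits the relation (s t)^m = e into
the braid relation, an equality of two alternating words of length m. *)
Lemma alt_word_zigzag s t k :
  alt_word s t k = rev (zigzag t s k) ++ zigzag s t k.
Proof.
elim: k s t => //= k IH s t; rewrite rev_rcons cat_cons -rcons_cat -IH.
by rewrite alt_word_rcons.
Qed.

Lemma zigzag_cat s t i k :
  exists2 p, zigzag s t (i + k) = p ++ zigzag s t k & size p = i.
Proof.
elim: i => [|i [p E sp]]; first by exists [::].
by rewrite addSn zigzagS E; eexists (_ :: p); rewrite //= sp.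
Qed.

Lemma braid s t : word_prod g (zigzag s t (cox_mx g s t)) =
  word_prod g (zigzag t s (cox_mx g s t)).
Proof.
have := word_prod_alt s t; rewrite alt_word_zigzag word_prod_cat word_prod_rev.
by move/eqP; rewrite mulg_eq1 => /eqP/invg_inj.
Qed.

End Words.

(** * The geometric representation *)

Section Representation.
Local Open Scope ring_scope.

Variables (W : groupType) (S : finType) (g : coxeter_system W S).
Variables (R : realFieldType) (c : nat -> R) (om : S -> S -> R).
Local Notation m := (cox_mx g).
Local Notation len := (cox_length g).
Local Notation V := {ffun S -> R^o}.

(** A Cartan matrix that is symmetric only up to the factors om s t: its
products K s t * K t s do not depend on om once om s t * om t s = 1. *)
Definition cartan s t : R := if s == t then 2 else - (om s t * c (m s t)).

Definition simple_root s : V := [ffun x => (x == s)%:R].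

Definition pairing s (v : V) : R := \sum_x cartan s x * v x.

Definition simple_refl s (v : V) : V := v - pairing s v *: simple_root s.

Fact pairing_linear s : scalar (pairing s).
Proof.
move=> a u v; rewrite /pairing mulr_sumr -big_split; apply: eq_bigr => x _.
by rewrite !ffunE /GRing.scale /=; ring.
Qed.
HB.instance Definition _ s :=
  GRing.isLinear.Build R V R _ (pairing s) (pairing_linear s).

Fact reflect_linear s : linear (simple_refl s).
Proof.
move=> a u v; rewrite /simple_refl linearP /= scalerBr scalerDl scalerA.
by rewrite opprD addrACA.
Qed.
HB.instance Definition _ s :=
  GRing.isLinear.Build R V V _ (simple_refl s) (reflect_linear s).

Fixpoint act p (v : V) : V :=
  if p is s :: p' then simple_refl s (act p' v) else v.

Fact act_linear p : linear (act p).
Proof. by elim: p => //= s p IH a u v; rewrite IH linearP. Qed.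
HB.instance Definition _ p :=
  GRing.isLinear.Build R V V _ (act p) (act_linear p).

Lemma act_cat p q v : act (p ++ q) v = act p (act q v).
Proof. by elim: p => //= s p ->. Qed.

Lemma act_rcons p s v : act (rcons p s) v = act p (simple_refl s v).
Proof. by rewrite -cats1 act_cat. Qed.

Lemma pairing_simple s t : pairing s (simple_root t) = cartan s t.
Proof.
rewrite /pairing (bigD1 t) //= ffunE eqxx mulr1 big1 ?addr0 // => x /negbTE xt.
by rewrite ffunE xt mulr0.
Qed.

Lemma reflect_simple s t :
  simple_refl s (simple_root t) = simple_root t - cartan s t *: simple_root s.
Proof. by rewrite /simple_refl pairing_simple. Qed.

Lemma reflect_self s : simple_refl s (simple_root s) = - simple_root s.
Proof.
by rewrite reflect_simple /cartan eqxx scaler_nat mulr2n opprD addNKr.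
Qed.

Lemma reflectK s : involutive (simple_refl s).
Proof.
move=> v; rewrite {2}/simple_refl linearB linearZ /= reflect_self /simple_refl.
by rewrite scalerN opprK subrK.
Qed.

Lemma act_revK p v : act p (act (rev p) v) = v.
Proof.
by elim: p v => //= s p IH v; rewrite rev_cons act_rcons IH reflectK.
Qed.

Lemma reflect_plane s t (a b : R) : s != t ->
  simple_refl t (a *: simple_root s + b *: simple_root t) =
  a *: simple_root s + (om t s * c (m t s) * a - b) *: simple_root t.
Proof.
move=> st; rewrite linearD !linearZ /= reflect_self reflect_simple /cartan.
rewrite eq_sym (negbTE st) scalerBr scalerN -addrA; congr (_ + _).
by rewrite scaleNr scalerN opprK scalerA scalerBl mulrC.
Qed.

Definition balanced := forall s t, 0 < om s t /\ om s t * om t s = 1.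

Hypothesis om_bal : balanced.
Hypothesis c_dih : forall k, k != 1%N -> dihedral_number k (c k).

Let om_gt0 s t : 0 < om s t. Proof. by case: (om_bal s t). Qed.
Let omK s t : om s t * om t s = 1. Proof. by case: (om_bal s t). Qed.

Lemma dihedral_ge0 k : k != 1%N -> 0 <= c k.
Proof.
move=> k1; have := cheb_ge0 (c_dih k1) (k := 2).
by rewrite chebSS mulr1 subr0; apply; case: k k1 => [|[]].
Qed.

Lemma dihedral_ge1 k : k != 1%N -> k != 2 -> 1 <= c k.
Proof.
move=> k1 k2; have := cheb_ge0 (c_dih k1) (k := 3).
have := dihedral_ge0 k1; rewrite !chebSS !mulr1 !subr0 => c0 H.
have : 0 <= c k * c k - 1 by apply: H; case: k k1 k2 {c0} => [|[|[]]].
by nra.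
Qed.

Lemma cartan_le0 s t : s != t -> cartan s t <= 0.
Proof.
move=> st; rewrite /cartan (negbTE st) oppr_le0 mulr_ge0 ?dihedral_ge0 //.
  by rewrite ltW.
exact: cox_mx_offdiag.
Qed.

(** One step of the Chebyshev recurrence for each of the two reflections. *)
Lemma reflect_alt s t (a : R) k : s != t ->
  simple_refl s (simple_refl t (a *: (cheb (c (m s t)) k.+1 *: simple_root s
    + (om t s * cheb (c (m s t)) k) *: simple_root t))) =
  a *: (cheb (c (m s t)) k.+3 *: simple_root s
    + (om t s * cheb (c (m s t)) k.+2) *: simple_root t).
Proof.
move=> st; rewrite !linearZ /=; congr (_ *: _).
rewrite reflect_plane // addrC reflect_plane 1?eq_sym //.
rewrite [LHS]addrC (cox_mx_sym g t s) !chebSS.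
by congr (_ *: _ + _ *: _); ring: (omK s t).
Qed.

Lemma act_alt s t k : s != t ->
  act (alt_word s t k) (simple_root s) =
  cheb (c (m s t)) k.*2.+1 *: simple_root s
    + (om t s * cheb (c (m s t)) k.*2) *: simple_root t.
Proof.
move=> st; elim: k => [|k IH]; first by rewrite mulr0 scale0r scale1r addr0.
rewrite [LHS]/= -/(alt_word s t k) IH.
by rewrite -[X in simple_refl t X]scale1r reflect_alt // scale1r.
Qed.

(** For s <> t and finite m the determinant 4 - c ^+ 2 is nonzero, so V is the
sum of the plane of alpha_s and alpha_t and of the common kernel of the two
pairings. On that kernel both reflections are trivial, and on the plane the
Chebyshev values at 2 m and 2 m + 1 give the identity. *)
Lemma act_alt_relation s t v : act (alt_word s t (m s t)) v = v.
Proof.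
have [<-|st] := eqVneq s t.
  by rewrite cox_mx_diag /= reflectK.
have [->//|] := posnP (m s t); move Em : (m s t) => k k0.
have k1 : k != 1%N by rewrite -Em cox_mx_offdiag.
have fix_s s' t' : s' != t' -> m s' t' = k ->
    act (alt_word s' t' k) (simple_root s') = simple_root s'.
  move=> st' E; rewrite act_alt // E (cheb_double (c_dih k1)) //.
  by rewrite (cheb_doubleS (c_dih k1)) // mulr0 scale0r scale1r addr0.
have fix_t : act (alt_word s t k) (simple_root t) = simple_root t.
  rewrite -{1}(fix_s t s) 1?cox_mx_sym 1?eq_sym //.
  suff -> : alt_word t s k = rev (alt_word s t k) by rewrite act_revK.
  by rewrite !alt_word_zigzag rev_cat revK.
have fix_perp u : pairing s u = 0 -> pairing t u = 0 ->
    act (alt_word s t k) u = u.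
  move=> us ut; elim: (k) => //= n; rewrite -/(alt_word s t n) => ->.
  by rewrite /simple_refl ut scale0r subr0 us scale0r subr0.
set p := pairing s v; set q := pairing t v.
have diag x : cartan x x = 2 by rewrite /cartan eqxx.
pose d := 4 - cartan s t * cartan t s.
have d0 : d != 0.
  rewrite /d /cartan [t == s]eq_sym (negbTE st) (cox_mx_sym g t s) Em.
  rewrite (_ : _ * _ = c k ^+ 2); last by ring: (omK s t).
  by rewrite subr_eq0 eq_sym (dihedral_det (c_dih k1)).
(* a and b solve the linear system that makes v - u orthogonal to both. *)
pose a := (2 * p - cartan s t * q) / d; pose b := (2 * q - cartan t s * p) / d.
set u := a *: simple_root s + b *: simple_root t.
have fu : act (alt_word s t k) u = u.
  by rewrite linearD !linearZ /= fix_s // fix_t.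
rewrite -(subrK u v) linearD /= fu fix_perp //.
- rewrite linearB linearD !linearZ /= !pairing_simple diag -/p /a /b.
  by rewrite /d in d0 *; field.
- rewrite linearB linearD !linearZ /= !pairing_simple diag -/q /a /b.
  by rewrite /d in d0 *; field.
Qed.

Lemma act_cong p q : cox_cong m p q -> act p =1 act q.
Proof.
elim=> {p q} [a b s t v|p v|p q _ IH v|p q r _ IH _ IH' v] //.
  by rewrite !act_cat act_alt_relation.
by rewrite IH.
Qed.

(** Any word for w would give the same map, by [rep_word]. *)
Definition rep w := act (reduced_word g w).
HB.instance Definition _ w := GRing.Linear.on (rep w).

Lemma rep_word p v : rep (word_prod g p) v = act p v.
Proof.
by apply: act_cong; apply/(cox_presented g); rewrite reduced_wordK.
Qed.

Lemma repM u w v : rep (u * w)%g v = rep u (rep w v).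
Proof.
by rewrite -{1}(reduced_wordK g u) -{1}(reduced_wordK g w) -word_prod_cat
  rep_word act_cat.
Qed.

Lemma rep1 v : rep 1%g v = v.
Proof. by have := rep_word [::] v; rewrite /word_prod big_nil. Qed.

Lemma rep_gen s v : rep (g s) v = simple_refl s v.
Proof. by rewrite -word_prod1 rep_word. Qed.

Definition nonneg (v : V) := forall x, 0 <= v x.

Lemma nonnegD u v : nonneg u -> nonneg v -> nonneg (u + v).
Proof. by move=> u0 v0 x; rewrite ffunE addr_ge0. Qed.

Lemma nonnegZ a v : 0 <= a -> nonneg v -> nonneg (a *: v).
Proof. by move=> a0 v0 x; rewrite ffunE mulr_ge0. Qed.

Lemma nonneg_simple s : nonneg (simple_root s).
Proof. by move=> x; rewrite ffunE ler0n. Qed.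

(** An alternating word of fewer than m letters keeps alpha_s nonnegative, as
cheb c k >= 0 for k <= m. The shift j makes the induction work: peeling off the
innermost letter exchanges s and t and raises j. *)
Lemma act_zigzag s t k a j : s != t -> 0 <= a ->
    (m s t == 0%N) || (j + k < m s t)%N ->
  exists x y, [/\ 0 <= x, 0 <= y &
    act (zigzag s t k) (a *: (cheb (c (m s t)) j.+1 *: simple_root s
      + (om t s * cheb (c (m s t)) j) *: simple_root t)) =
    x *: simple_root s + y *: simple_root t].
Proof.
elim: k s t a j => [|k IH] s t a j st a0 jk.
  have H := cheb_ge0 (c_dih (cox_mx_offdiag g st)).
  exists (a * cheb (c (m s t)) j.+1), (a * (om t s * cheb (c (m s t)) j)).
  rewrite scalerDr !scalerA; rewrite addn0 in jk; split=> //.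
    by rewrite mulr_ge0 // H.
  rewrite !mulr_ge0 ?(ltW (om_gt0 _ _)) ?H //.
  by case/orP: jk => [->//|/ltnW ->]; rewrite orbT.
have [|||x [y [x0 y0 E]]] := IH t s (a * om t s) j.+1.
- by rewrite eq_sym.
- by rewrite mulr_ge0 // ltW.
- by rewrite cox_mx_sym addSnnS.
exists y, x; split=> //; rewrite [RHS]addrC -E /= act_rcons; congr (act _ _).
rewrite linearZ /= reflect_plane // -scalerA; congr (_ *: _).
rewrite scalerDr !scalerA addrC (cox_mx_sym g t s); congr (_ *: _ + _ *: _).
  by rewrite chebSS; ring.
by rewrite mulrA omK mul1r.
Qed.



(** The sign property of roots: no root has coordinates of both signs. Strip
from the right of w letters alternately equal to t, s, t, ... as long as the
length drops, t being a right descent of w; what remains is some v which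
neither s nor t shortens, to which induction applies. Fewer than m letters were
stripped, since otherwise a braid move would let w end in s. So the stripped
word maps alpha_s to a nonnegative combination of alpha_s and alpha_t, and both
have nonnegative images under v. *)
Lemma rep_root_nonneg w s :
  (len w <= len (w * g s)%g)%N -> nonneg (rep w (simple_root s)).
Proof.
move En : (len w) => n; elim/ltn_ind: n w s En => n IH w s En ns.
have [->|w1] := eqVneq w 1%g; first by rewrite rep1; exact: nonneg_simple.
have [t Et] := cox_length_last g w1.
have st : s != t.
  by apply: contraTneq ns => ->; rewrite -En Et ltnn.
(* v k is w without its last k letters, if they alternate and end in t. *)
pose v k := (w * (word_prod g (zigzag s t k))^-1)%g.
pose P k := (len (v k) + k == n)%N.
have vS k : v k.+1 = (v k * g (if odd k then s else t))%g.
  by rewrite /v zigzagS word_prod_cons invgM cox_genV mulgA.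
have P1 : P 1%N.
  by rewrite /P /v /= word_prod1 cox_genV addn1 -Et En.
have [k Pk kmax] := ex_maxnP (ex_intro P _ P1) (m := n)
  (fun k Pk => leq_trans (leq_addl _ _) (eq_leq (eqP Pk))).
have k1 := kmax _ P1.
have lenv : len (v k) = (n - k)%N by rewrite -(eqP Pk) addnK.
have kn : (k <= n)%N by rewrite -(eqP Pk) leq_addl.
have up_next : (len (v k) <= len (v k * g (if odd k then s else t))%g)%N.
  have := cox_length_mulr g (v k) (if odd k then s else t).
  rewrite leq_eqVlt => /orP[/eqP E|//].
  have /kmax : P k.+1 by rewrite /P vS addnS -addSn -E.
  by rewrite ltnn.
have up_prev : (len (v k) <= len (v k * g (if odd k then t else s))%g)%N.
  case: k k1 {Pk kmax up_next} lenv kn => // k _ lenv kn.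
  rewrite {2}vS (_ : (if odd k.+1 then t else s) = if odd k then s else t).
    rewrite mulgenK lenv leq_subLR.
    have := cox_lengthM g (v k) (word_prod g (zigzag s t k)).
    rewrite /v mulgVK En => /leq_trans; apply.
    rewrite addnC addSn (leq_trans _ (leqnSn _)) // leq_add2r.
    by rewrite (leq_trans (cox_length_le _ _)) ?size_zigzag.
  by rewrite /=; case: (odd k).
have ups r : r \in [:: s; t] -> (len (v k) <= len (v k * g r)%g)%N.
  rewrite !inE; case: (odd k) up_next up_prev => H1 H2 /orP[]/eqP-> //.
have vw : w = (v k * word_prod g (zigzag s t k))%g by rewrite /v mulgVK.
(* Had m s t letters or more been stripped, a braid move would show s as a right
   descent of w. *)
have km : (m s t == 0%N) || (0 + k < m s t)%N.
  rewrite add0n; case: posnP => //= m0; rewrite ltnNge; apply/negP => mk.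
  have [p Ep sp] := zigzag_cat s t (k - m s t) (m s t).
  rewrite subnK // in Ep.
  move: ns; rewrite {1}vw Ep word_prod_cat braid.
  rewrite -(prednK m0) /= word_prod_rcons !mulgA mulgenK -mulgA -word_prod_cat.
  rewrite leqNgt => /negP; apply.
  rewrite (leq_ltn_trans (cox_lengthM _ _ _)) // lenv.
  rewrite -ltn_subRL subKn // (leq_ltn_trans (cox_length_le _ _)) //.
  rewrite size_cat sp size_zigzag -{2}(subnK mk) ltn_add2l.
  by rewrite ltn_predL.
have [x [y [x0 y0 E]]] := act_zigzag st ler01 km.
rewrite {1}vw repM rep_word.
move: E; rewrite scale1r mulr0 scale0r addr0 [cheb _ 1]/(1) scale1r => ->.
have pos r : r \in [:: s; t] -> nonneg (rep (v k) (simple_root r)).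
  move=> /ups; apply: (IH (len (v k))) => //.
  by rewrite lenv ltn_subrL k1 (leq_trans k1 kn).
rewrite linearD !linearZ /=.
by apply: nonnegD; apply: nonnegZ => //; apply: pos; rewrite !inE eqxx ?orbT.
Qed.

Lemma rep_root_nonpos w s :
  (len (w * g s)%g <= len w)%N -> nonneg (- rep w (simple_root s)).
Proof.
move=> ws; rewrite -linearN /= -reflect_self -rep_gen -repM.
by apply: rep_root_nonneg; rewrite mulgenK.
Qed.

Lemma rep_inj w : injective (rep w).
Proof.
by apply: (can_inj (g := rep w^-1%g)) => v; rewrite -repM mulVg rep1.
Qed.

Lemma simple_root_neq0 s : simple_root s != 0.
Proof.
by apply/eqP => /ffunP/(_ s); rewrite !ffunE eqxx => /eqP; rewrite oner_eq0.
Qed.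

Lemma nonneg_anti v : nonneg v -> nonneg (- v) -> v = 0.
Proof.
move=> v0 v0'; apply/ffunP => x; rewrite ffunE; apply/le_anti/andP.
by have := v0' x; rewrite ffunE oppr_ge0.
Qed.

Lemma root_sign w s :
  nonneg (rep w (simple_root s)) -> nonneg (- rep w (simple_root s)) -> False.
Proof.
move=> v0 v0'; have /eqP := nonneg_anti v0 v0'.
rewrite -(linear0 (rep w)) (inj_eq (@rep_inj w)).
by rewrite (negbTE (simple_root_neq0 s)).
Qed.

Definition inverted w v := nonneg (- rep w^-1%g v).

Lemma left_descentP w s :
  (len (g s * w)%g < len w)%N <-> inverted w (simple_root s).
Proof.
rewrite -(cox_lengthV g w) -(cox_lengthV g (g s * w)%g) invgM cox_genV.
split=> [/ltnW|H]; first exact: rep_root_nonpos.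
rewrite ltnNge; apply/negP => le.
exact: (root_sign (rep_root_nonneg le) H).
Qed.

Lemma inverted_reflect w s v :
  inverted w (simple_refl s v) <-> inverted (g s * w)%g v.
Proof. by rewrite /inverted invgM cox_genV repM rep_gen. Qed.

Lemma pairing_le0 s v : nonneg v -> v s = 0 -> pairing s v <= 0.
Proof.
move=> v0 vs; apply: sumr_le0 => x _; have [->|sx] := eqVneq x s.
  by rewrite vs mulr0.
by apply: mulr_le0_ge0 => //; apply: cartan_le0; rewrite eq_sym.
Qed.

Lemma reflectE s v x : x != s -> simple_refl s v x = v x.
Proof. by move=> /negbTE xs; rewrite !ffunE xs /GRing.scale /= mulr0 subr0. Qed.

(** Each letter y of p differs from the letters to its right, so it pairs
nonpositively with the vector it meets and only adds to the coordinate y. *)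
Lemma act_uniq p s : uniq (rcons p s) ->
  [/\ nonneg (act p (simple_root s)), act p (simple_root s) s = 1 &
      forall x, x \notin rcons p s -> act p (simple_root s) x = 0].
Proof.
elim: p => [_|t p IH] /=.
  split; first exact: nonneg_simple.
    by rewrite ffunE eqxx.
  by move=> x; rewrite inE ffunE => /negbTE ->.
case/andP=> tp /IH[v0 vs vn]; split.
- move=> x; have [->|xt] := eqVneq x t; last by rewrite reflectE.
  rewrite !ffunE eqxx /GRing.scale /= mulr1 vn // sub0r oppr_ge0.
  by apply: pairing_le0 => //; apply: vn.
- by rewrite reflectE //; apply: contraNneq tp => ->;
    rewrite mem_rcons mem_head.
- by move=> x; rewrite inE negb_or => /andP[xt xp]; rewrite reflectE // vn.
Qed.

(** Otherwise some letter s would not lengthen the prefix before it, and that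
prefix would send alpha_s to a nonpositive vector, against the coordinate 1 at
s. *)
Lemma cox_length_uniq p : uniq p -> len (word_prod g p) = size p.
Proof.
elim/last_ind: p => [|p s IH] Up.
  by rewrite /word_prod big_nil cox_length1.
have [v0 vs _] := act_uniq Up.
move: Up; rewrite rcons_uniq => /andP[_ /IH {}IH].
apply/eqP; rewrite eqn_leq cox_length_le size_rcons -IH ltnNge.
rewrite word_prod_rcons; apply/negP => /rep_root_nonpos /(_ s).
by rewrite rep_word ffunE vs oppr_ge0 ler10.
Qed.

Lemma weak_le_cons s p w : uniq (s :: p) ->
  weak_le g (word_prod g (s :: p)) w =
  (len (g s * w)%g < len w)%N && weak_le g (word_prod g p) (g s * w)%g.
Proof.
move=> Usp; have Up : uniq p by case/andP: Usp.
rewrite /weak_le !cox_length_uniq // word_prod_cons invgM cox_genV -mulgA.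
have H1 := cox_length_mull g w s.
have := cox_lengthM g (word_prod g p) ((word_prod g p)^-1 * (g s * w))%g.
rewrite mulVKg cox_length_uniq //= => H2.
apply/eqP/andP => [E|[H /eqP E]].
  have Ew : (len (g s * w)%g).+1 = len w.
    by apply/eqP; rewrite eqn_leq H1 andbT -E addSn ltnS.
  by rewrite -Ew ltnSn -eqSS Ew -E addSn.
by apply/eqP; rewrite addSn E eqn_leq H.
Qed.

(** Inclusion of inversion sets, one letter at a time: when the first letter s
of p is a left descent of w, the other roots of p are inverted by w exactly
when those of the tail of p are inverted by s w. *)
Lemma weak_leP p w : uniq p ->
  weak_le g (word_prod g p) w <->
  forall a s b, p = a ++ s :: b -> inverted w (act a (simple_root s)).
Proof.
elim: p w => [|s p IH] w Up.
  split=> [_ [] //|_]; rewrite /weak_le /word_prod big_nil cox_length1.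
  by rewrite invg1 mul1g.
rewrite weak_le_cons //; have [_ Up'] := andP Up; split.
  case/andP=> /left_descentP Ds /(IH _ Up') H [|t a] u b [<-] //.
  by move/H/inverted_reflect.
move=> H; apply/andP; split; first by apply/left_descentP; exact: (H [::]).
apply/(IH _ Up') => a t b E; apply/inverted_reflect.
by apply: (H (s :: a) t b); rewrite E.
Qed.

(** An inversion u of w avoiding x in its support gives an inversion of x w,
since x . u is the sum of u and a nonnegative multiple of alpha_x, both
inverted by w. *)
Lemma weak_le_gen_mul x p w : uniq p -> x \notin p ->
  (len (g x * w)%g < len w)%N -> weak_le g (word_prod g p) w ->
  weak_le g (word_prod g p) (g x * w)%g.
Proof.
move=> Up xp /left_descentP Dx /(weak_leP _ Up) H; apply/(weak_leP _ Up).
move=> a s b E; apply/inverted_reflect; rewrite /inverted /simple_refl.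
have /act_uniq[v0 _ vn] : uniq (rcons a s).
  by move: Up; rewrite E -cat_rcons cat_uniq => /andP[].
rewrite linearB linearZ /= opprB addrC -[_ *: rep _ _]opprK -scalerN -scaleNr.
apply: nonnegD; first exact: (H a s b E).
apply: nonnegZ => //; rewrite oppr_ge0; apply: pairing_le0 => //.
by apply: vn; apply: contra xp; rewrite E -cat_rcons mem_cat => ->.
Qed.

(** Along a reduced word each letter s adds a nonnegative multiple of the image
of alpha_s under the letters before it, which is nonnegative. *)
Lemma rep_antidominant v u :
  (forall s, pairing s v <= 0) -> nonneg (rep u v - v).
Proof.
move=> v0; move En : (len u) => n; elim: n u En => [|n IH] u En.
  have [->|/(cox_length_last g)[s]] := eqVneq u 1%g; last by rewrite En.
  by rewrite rep1 subrr => x; rewrite ffunE.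
have [E|/(cox_length_last g)[s]] := eqVneq u 1%g.
  by rewrite E cox_length1 in En.
rewrite En => -[us]; rewrite -(mulgenK g u s) repM rep_gen linearB linearZ /=.
rewrite addrAC -scaleNr; apply: nonnegD; first exact: IH.
apply: nonnegZ; first by rewrite oppr_ge0.
by apply: rep_root_nonneg; rewrite mulgenK En us.
Qed.

(** The representation sees the diagram: the two products of the reflections at
s and t send alpha_t to vectors whose coordinates at s are K s t and - K s t. *)
Lemma cartan_commute s t : s != t -> ~~ diagram g s t -> cartan s t = 0.
Proof.
move=> st; rewrite /diagram st /= negbK => /eqP com.
have := congr1 (fun w => rep w (simple_root t) s) com.
rewrite !repM !rep_gen reflect_self linearN /= [RHS]reflectE //.
rewrite !reflect_simple !ffunE eqxx (negbTE st) /GRing.scale /=; lra.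
Qed.

Lemma diagram_dihedral_ge1 s t : diagram g s t -> 1 <= c (m s t).
Proof.
case/andP=> st ncom; apply: dihedral_ge1; first exact: cox_mx_offdiag.
apply: contraNneq ncom => E; have := word_prod_alt g s t.
rewrite E /alt_word /= /word_prod !big_cons big_nil mulg1 => /eqP.
rewrite mulgA mulg_eq1 invgM !cox_genV => /eqP ->.
by rewrite eqxx.
Qed.

(** When x occurs in p, these are the inversions of the product of p. *)
Definition prefix_root p x : V := act (take (index x p) p) (simple_root x).

(** At each letter y the reflection subtracts K y x times alpha_y from alpha_x,
and the letters before y turn this alpha_y into the prefix root of y. *)
Lemma act_take p n x : uniq p ->
  act (take n p) (simple_root x) =
  simple_root x - \sum_(y <- take n p) cartan y x *: prefix_root p y.
Proof.
move=> Up; elim: n => [|n IH]; first by rewrite take0 big_nil subr0.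
have [np|pn] := ltnP n (size p); last first.
  by rewrite take_oversize ?leqW // -(take_oversize pn) IH (take_oversize pn).
rewrite (take_nth x) // act_rcons reflect_simple linearB linearZ /= IH.
rewrite -cats1 big_cat big_seq1 /= opprD addrA; congr (_ - _ *: _).
by rewrite /prefix_root index_uniq.
Qed.

Lemma inverted_prefix_root p x w : uniq p -> weak_le g (word_prod g p) w ->
  x \in p -> inverted w (prefix_root p x).
Proof.
move=> Up /(weak_leP _ Up) H xp; apply: (H _ x (drop (index x p).+1 p)).
by rewrite -[X in X :: _](nth_index x xp) -drop_nth ?index_mem // cat_take_drop.
Qed.

End Representation.

(** * No cyclic set is covered by two acyclic sets below w *)

Section Orientation.
Local Open Scope ring_scope.

Variables (W : groupType) (S : finType) (g : coxeter_system W S).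
Variable (O : orientation (diagram g)).

Lemma orient_asym s t : O s t -> ~~ O t s.
Proof. by move=> st; have := orient_one_way O (orient_edge st); rewrite st. Qed.

Section Weights.

Variables (R : realFieldType) (c : nat -> R) (T : {set S}).
Hypothesis c_dih : forall k, k != 1%N -> dihedral_number k (c k).

Definition indeg x : R := #|[set y in T | O y x]|%:R.

(** Chosen so that K t s = - 1 / indeg t for every arrow s -> t in T; balance
then forces the weight in the other direction. *)
Definition weight s t : R :=
  if (s \in T) && (t \in T) then
    if O t s then (c (cox_mx g s t) * indeg s)^-1
    else if O s t then c (cox_mx g s t) * indeg t else 1
  else 1.

Lemma indeg_ge1 s t : s \in T -> O s t -> 1 <= indeg t.
Proof.
move=> sT st; rewrite /indeg ler1n card_gt0; apply/set0Pn; exists s.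
by rewrite inE sT.
Qed.

Lemma weight_balanced : balanced weight.
Proof.
have pos s t : s \in T -> O s t -> 0 < c (cox_mx g s t) * indeg t.
  move=> sT st; rewrite mulr_gt0 // (lt_le_trans ltr01) //.
    exact: diagram_dihedral_ge1 (orient_edge st).
  exact: indeg_ge1 st.
move=> s t; rewrite /weight [(t \in T) && _]andbC.
have [/andP[sT tT]|_] := boolP (_ && _); last by rewrite mulr1.
have [ts|nts] := boolP (O t s).
  rewrite (negbTE (orient_asym ts)) (cox_mx_sym g s t) invr_gt0 pos //.
  by rewrite mulVf // gt_eqF // pos.
have [st|nst] := boolP (O s t); last by rewrite mulr1.
by rewrite (cox_mx_sym g t s) pos // divff // gt_eqF // pos.
Qed.

Local Notation K := (cartan g c weight).

Lemma orient_neq s t : O s t -> s != t.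
Proof. by move/orient_edge => /andP[]. Qed.

Lemma cartan_back s t : s \in T -> t \in T -> O t s -> K s t = - (indeg s)^-1.
Proof.
move=> sT tT ts; rewrite /cartan eq_sym (negbTE (orient_neq ts)).
rewrite /weight sT tT ts /=.
have c1 : 1 <= c (cox_mx g s t).
  by rewrite cox_mx_sym; apply: diagram_dihedral_ge1 (orient_edge ts).
by rewrite invfM mulrAC mulVf ?mul1r // gt_eqF // (lt_le_trans ltr01).
Qed.

(** Here - K s t is the product of indeg t >= 1 and of the square of c >= 1. *)
Lemma cartan_forth s t : s \in T -> t \in T -> O s t -> K s t <= -1.
Proof.
move=> sT tT st; rewrite /cartan (negbTE (orient_neq st)) /weight sT tT.
rewrite (negbTE (orient_asym st)) st lerN2 /=.
have c1 : 1 <= c (cox_mx g s t) by apply: diagram_dihedral_ge1 (orient_edge st).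
have := indeg_ge1 sT st; nra.
Qed.

Variables (w : W) (p1 p2 : seq S).
Hypothesis T_neq0 : T != set0.
Hypothesis T_succ : forall x, x \in T -> exists2 y, y \in T & O x y.
Hypothesis T_pred : forall x, x \in T -> exists2 y, y \in T & O y x.
Hypothesis T_cover : forall x, x \in T -> (x \in p1) || (x \in p2).
Hypothesis T_closed : forall x y, x \in T -> O x y ->
  (y \in p1) || (y \in p2) -> y \in T.

Local Notation root := (@simple_root S R).

Let v : {ffun S -> R^o} := \sum_(x in T) root x.

(** For s in T the diagonal contributes 2, the predecessors of s in T
contribute -1 in total and one successor already at most -1. *)
Lemma pairing_indicator s : pairing g c weight s v <= 0.
Proof.
rewrite /v linear_sum /=; under eq_bigr do rewrite pairing_simple.
have le0 x : s != x -> K s x <= 0.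
  by apply: cartan_le0 => //; exact: weight_balanced.
have [sT|sT] := boolP (s \in T); last first.
  apply: sumr_le0 => x xT; apply: le0; apply: contraNneq sT => ->; exact: xT.
have [y yT sy] := T_succ sT; have [z zT zs] := T_pred sT.
have ds := indeg_ge1 zT zs.
(* F keeps only the diagonal, the predecessors of s and the successor y. *)
pose F x : R := 2 * (x == s)%:R - (O x s)%:R / indeg s - (x == y)%:R.
have KF x : x \in T -> K s x <= F x.
  move=> xT; rewrite /F.
  have [->|xs] := eqVneq x s.
    rewrite /cartan eqxx (negbTE (orient_irr O s)) (negbTE (orient_neq sy)) /=.
    by rewrite mul0r !subr0 mulr1.
  have [->|xy] := eqVneq x y.
    rewrite (negbTE (orient_asym sy)) /= mulr0 mul0r subr0 sub0r.
    exact: cartan_forth sT yT sy.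
  have [xs'|_] := boolP (O x s).
    by rewrite cartan_back //= mulr0 sub0r subr0 mul1r.
  by rewrite /= mulr0 mul0r !subr0; apply: le0; rewrite eq_sym.
have sum1 a : a \in T -> \sum_(x in T) (x == a)%:R = 1 :> R.
  move=> aT; rewrite (bigD1 a) //= eqxx big1 ?addr0 // => x.
  by case/andP=> _ /negbTE ->.
apply: (le_trans (ler_sum _ KF)); rewrite /F !sumrB -mulr_sumr -mulr_suml.
rewrite !sum1 // -natr_sum -big_mkcondr sum1_card.
rewrite (_ : #|_| = #|[set x in T | O x s]|); last first.
  by apply: eq_card => x; rewrite !inE.
rewrite -/(indeg s) divff ?gt_eqF ?(lt_le_trans ltr01) //; lra.
Qed.

(** A linear functional that is nonnegative on everything that w inverts. *)
Let depth (u : {ffun S -> R^o}) : R := - \sum_x rep g c weight w^-1%g u x.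

Fact depth_linear : scalar depth.
Proof.
move=> a u1 u2; rewrite /depth mulrN mulr_sumr -opprD -big_split; congr (- _).
by apply: eq_bigr => x _; rewrite linearP !ffunE.
Qed.
HB.instance Definition _ :=
  GRing.isLinear.Build R {ffun S -> R^o} R _ depth depth_linear.

Lemma depth_inverted u : inverted g c weight w u -> 0 <= depth u.
Proof.
move=> u0; rewrite /depth -sumrN; apply: sumr_ge0 => x _.
by have := u0 x; rewrite ffunE.
Qed.

Lemma depth_indicator : depth v < 0.
Proof.
have H := rep_antidominant weight_balanced c_dih w^-1%g pairing_indicator.
rewrite oppr_lt0; have /set0Pn[a aT] := T_neq0.
have vE x : v x = (x \in T)%:R.
  rewrite /v sum_ffunE; under eq_bigr do rewrite ffunE.
  have [xT|xT] := boolP (x \in T).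
    rewrite (bigD1 x) //= eqxx big1 ?addr0 // => y /andP[_].
    by rewrite eq_sym => /negbTE ->.
  rewrite big1 // => y yT; case: eqP => // bound; by rewrite bound yT in xT.
apply: (@lt_le_trans _ _ (\sum_x v x)).
  rewrite (bigD1 a) //= vE aT ltr_pwDl // sumr_ge0 // => x _.
  by rewrite vE.
by apply: ler_sum => x _; have := H x; rewrite !ffunE subr_ge0.
Qed.

(** The value 0 off p makes the maximum over two words meaningful at a letter
that only one of them contains. *)
Let root_depth p x : R :=
  if x \in p then depth (prefix_root g c weight p x) else 0.

Lemma root_depth_ge0 p x :
  uniq p -> weak_le g (word_prod g p) w -> 0 <= root_depth p x.
Proof.
rewrite /root_depth => Up pw; case: ifP => // xp; apply: depth_inverted.
exact: (inverted_prefix_root weight_balanced c_dih Up pw xp).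
Qed.

Let max_depth x := Num.max (root_depth p1 x) (root_depth p2 x).

(** The recurrence for prefix roots, bounded above: compatibility of p with the
orientation leaves only letters y with an arrow x -> y, the others having K y x
= 0, and these lie in T since T is closed under successors. *)
Lemma root_depth_le p x :
  uniq p -> compatible O p -> weak_le g (word_prod g p) w ->
  x \in T -> x \in p ->
  (forall y, root_depth p y <= max_depth y) -> (forall y, 0 <= max_depth y) ->
  (forall y, O x y -> y \in p -> y \in T) ->
  root_depth p x <= depth (root x)
    + \sum_(y in T | O x y) (indeg y)^-1 * max_depth y.
Proof.
move=> Up Cp pw xT xp hG G0 closed.
rewrite {1}/root_depth xp /prefix_root act_take //= linearB lerD2l.
rewrite linear_sum -sumrN /=.
rewrite big_uniq ?take_uniq //=.
rewrite big_mkcond [leRHS]big_mkcond; apply: ler_sum => y _.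
have nn : 0 <= (indeg y)^-1 * max_depth y by rewrite mulr_ge0 // invr_ge0 ler0n.
have [yx|_] := boolP (y \in _); last by case: ifP.
have yp := mem_take yx.
have lt : (index y p < index x p)%N by rewrite -in_take.
have xy : x != y by apply: contraTneq lt => ->; rewrite ltnn.
have nyx : ~~ O y x.
  apply: contraTN lt => oyx; rewrite -leqNgt ltnW //.
  by have /forall_inP/(_ x xp) := forall_inP Cp y yp; rewrite oyx.
have [oxy|noxy] := boolP (O x y).
  have yT := closed y oxy yp.
  rewrite yT /= linearZ /= cartan_back // mulNr opprK.
  apply: ler_wpM2l; first by rewrite invr_ge0 ler0n.
  by have := hG y; rewrite /root_depth yp.
rewrite cartan_commute ?scale0r ?linear0 ?oppr0; first by case: ifP.
- exact: weight_balanced.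
- exact: c_dih.
- by rewrite eq_sym.
apply/negP => e; have := orient_one_way O e.
by rewrite (negbTE nyx) (negbTE noxy).
Qed.

(** Summing max_depth x <= depth (root x) + ... over T, each max_depth y is
counted on the right once for each of its indeg y predecessors, with weight 1 /
indeg y. So the sums of max_depth cancel and depth v is nonnegative. *)
Lemma no_cyclic_cover :
  uniq p1 -> compatible O p1 -> weak_le g (word_prod g p1) w ->
  uniq p2 -> compatible O p2 -> weak_le g (word_prod g p2) w -> False.
Proof.
move=> U1 C1 w1 U2 C2 w2.
have h1 x := root_depth_ge0 x U1 w1; have h2 x := root_depth_ge0 x U2 w2.
have hG1 x : root_depth p1 x <= max_depth x by rewrite le_max lexx.
have hG2 x : root_depth p2 x <= max_depth x by rewrite le_max lexx orbT.
have G0 x : 0 <= max_depth x by apply: le_trans (hG1 x).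
pose bound x :=
  depth (root x) + \sum_(y in T | O x y) (indeg y)^-1 * max_depth y.
have H1 x : x \in T -> x \in p1 -> root_depth p1 x <= bound x.
  move=> xT xp; apply: root_depth_le => // y xy yp.
  by apply: T_closed xT xy _; rewrite yp.
have H2 x : x \in T -> x \in p2 -> root_depth p2 x <= bound x.
  move=> xT xp; apply: root_depth_le => // y xy yp.
  by apply: T_closed xT xy _; rewrite yp orbT.
have HG x : x \in T -> max_depth x <= bound x.
  move=> xT; have E0 : 0 <= bound x.
    by case/orP: (T_cover xT) => xp;
      [move: (H1 x xT xp) | move: (H2 x xT xp)]; apply: le_trans.
  rewrite ge_max; apply/andP; split.
    have [xp|xp] := boolP (x \in p1); first exact: H1.
    by rewrite /root_depth (negbTE xp).
  have [xp|xp] := boolP (x \in p2); first exact: H2.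
  by rewrite /root_depth (negbTE xp).
(* depth v < 0 by antidominance; the bounds on max_depth give depth v >= 0. *)
have := depth_indicator; rewrite ltNge => /negP; apply.
have : \sum_(x in T) max_depth x <= \sum_(x in T) bound x by apply: ler_sum.
rewrite /bound /= big_split /= /v linear_sum /=.
rewrite [X in _ <= _ + X](_ : _ = \sum_(y in T) max_depth y).
  by rewrite -lerBlDr subrr.
rewrite (exchange_big_dep (mem T)) /=; last by move=> x y _ /andP[].
apply: eq_bigr => y yT; rewrite -mulr_suml sumr_const.
rewrite (_ : #|_| = #|[set x in T | O x y]|); last first.
  by apply: eq_card => x; rewrite !inE yT.
have [z zT zy] := T_pred yT.
rewrite -mulr_natr -/(indeg y) mulVf ?mul1r // gt_eqF //.
exact: lt_le_trans ltr01 (indeg_ge1 zT zy).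
Qed.

End Weights.
End Orientation.

(** * Acyclic sets below w are closed under union *)

Section AcyclicBelow.
Variables (W : groupType) (S : finType) (g : coxeter_system W S).
Variable (O : orientation (diagram g)).
Local Notation Rr := Rdefinitions.R.
Local Notation below := (acyclic_below O).

Let c_dih := @dihedral_cosP Rr.
(* Facts about words alone do not depend on the weights: take the symmetric
   Cartan matrix. *)
Let om0 (s t : S) : Rr := 1%R.
Let om0_bal : balanced om0.
Proof. by move=> s t; rewrite /om0 ltr01 mulr1. Qed.

(** Searching for such a p among the finitely many orderings of J decides
whether J is acyclic and below w. *)
Definition ordered_below w (J : {set S}) (p : seq S) :=
  [&& perm_eq p (enum J), compatible O p & weak_le g (word_prod g p) w].

(** Arrows lower the position in p, so a cycle has no vertex of least
position. *)
Lemma compatible_acyclic (J : {set S}) p :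
  perm_eq p (enum J) -> compatible O p -> acyclic O J.
Proof.
move=> pJ Cp q qJ /andP[cq Uq]; case: q qJ cq Uq => // x q qJ cq Uq.
have memp y : y \in x :: q -> y \in p.
  by move=> /qJ yJ; rewrite (perm_mem pJ) mem_enum.
case: (arg_minnP (fun y => index y p) (mem_head x q)) => y yq ymin.
have nq : next (x :: q) y \in x :: q by rewrite mem_next.
have := forall_inP (forall_inP Cp y (memp _ yq)) _ (memp _ nq).
by rewrite (next_cycle cq yq) ltnNge ymin.
Qed.

Lemma acyclic_belowP w J :
  reflect (below w J) (has (ordered_below w J) (permutations (enum J))).
Proof.
apply: (iffP hasP) => [[p _ /and3P[pJ Cp pw]]|[aJ wJ]].
  split; first exact: compatible_acyclic Cp.
  by rewrite (cox_elt_eq pJ Cp).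
have [p pJ Cp] := compatible_ex (orient_irr O) aJ.
exists p; first by rewrite mem_permutations.
by rewrite /ordered_below pJ Cp -(cox_elt_eq pJ Cp).
Qed.

Lemma belowP w J : below w J <-> exists p, ordered_below w J p.
Proof.
split=> [/acyclic_belowP/hasP[p _ H]|[p H]]; first by exists p.
apply/acyclic_belowP/hasP; exists p => //; rewrite mem_permutations.
by case/andP: H.
Qed.

Lemma ordered_uniq w J p : ordered_below w J p -> uniq p.
Proof. by case/andP=> pJ _; rewrite (perm_uniq pJ) enum_uniq. Qed.

Lemma ordered_mem w J p : ordered_below w J p -> p =i J.
Proof. by case/andP=> pJ _ x; rewrite (perm_mem pJ) mem_enum. Qed.

Definition sink (J : {set S}) x := [forall y in J, ~~ O x y].

Lemma perm_enum_setD1 (J : {set S}) x p : x \in J ->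
  perm_eq (x :: p) (enum J) = perm_eq p (enum (J :\ x)).
Proof.
move=> xJ; rewrite -(perm_cons x p).
have /permPr E : perm_eq (enum J) (x :: enum (J :\ x)).
  apply: uniq_perm; rewrite /= ?enum_uniq ?andbT //.
    by rewrite mem_enum !inE eqxx.
  by move=> y; rewrite inE !mem_enum !inE; case: eqP => // ->.
by rewrite E.
Qed.

Lemma compatible_cons (J : {set S}) x p : x \in J -> sink J x ->
  perm_eq p (enum (J :\ x)) -> compatible O (x :: p) = compatible O p.
Proof.
move=> xJ /forall_inP sx pJ.
have Up : uniq p by rewrite (perm_uniq pJ) enum_uniq.
have memp y : y \in p -> y \in J :\ x by rewrite (perm_mem pJ) mem_enum.
have xp : x \notin p by apply/negP => /memp; rewrite !inE eqxx.
rewrite !compatible_pairwise /= ?xp //; try exact: orient_irr.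
rewrite (_ : all _ _) //; apply/allP => y /memp; rewrite inE => /andP[_].
exact: sx.
Qed.

(** A sink can always be placed first. *)
Lemma below_sink w (J : {set S}) x : x \in J -> sink J x ->
  below w J <->
  (cox_length g (g x * w)%g < cox_length g w)%N /\ below (g x * w)%g (J :\ x).
Proof.
move=> xJ sx; split.
  case/belowP => p H; have Up := ordered_uniq H; have memp := ordered_mem H.
  case/and3P: H => pJ Cp pw.
  have xp : x \in p by rewrite memp.
  have pq := perm_to_rem xp.
  have qJ : perm_eq (rem x p) (enum (J :\ x)).
    by rewrite -perm_enum_setD1 // -(permPl pq).
  have Cxq : compatible O (x :: rem x p).
    rewrite (compatible_cons xJ sx qJ) compatible_pairwise ?rem_uniq //.
      apply: subseq_pairwise (rem_subseq x p) _.
      by rewrite -compatible_pairwise //; exact: orient_irr.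
    exact: orient_irr.
  have Uxq : uniq (x :: rem x p) by rewrite -(perm_uniq pq).
  move: pw; rewrite (word_prod_compatible Up pq Cp Cxq).
  rewrite (weak_le_cons g om0_bal c_dih) // => /andP[D qw]; split=> //.
  apply/belowP; exists (rem x p).
  by rewrite /ordered_below qJ qw -(compatible_cons xJ sx qJ) Cxq.
case=> D /belowP[p H]; have Up := ordered_uniq H; have memp := ordered_mem H.
case/and3P: H => pJ Cp pw; apply/belowP; exists (x :: p).
rewrite /ordered_below perm_enum_setD1 // pJ (compatible_cons xJ sx pJ) Cp.
by rewrite (weak_le_cons g om0_bal c_dih) ?D //= memp !inE eqxx.
Qed.

Lemma below_descent w (J : {set S}) x : x \notin J ->
  (cox_length g (g x * w)%g < cox_length g w)%N -> below w J ->
  below (g x * w)%g (J :\ x).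
Proof.
move=> xJ D /belowP[p H]; have Up := ordered_uniq H; have memp := ordered_mem H.
case/and3P: H => pJ Cp pw; apply/belowP; exists p.
rewrite /ordered_below Cp (weak_le_gen_mul om0_bal c_dih) ?memp // andbT.
rewrite (_ : J :\ x = J) ?pJ //; apply/setDidPl.
by rewrite disjoint_sym disjoints1.
Qed.

(** Without a sink, a minimal nonempty successor-closed T would have a
predecessor for each of its vertices, as a vertex without one could be removed
from T; this is the situation that [no_cyclic_cover] rules out. *)
Lemma ex_common_sink w (J1 J2 : {set S}) : below w J1 -> below w J2 ->
  J1 :|: J2 != set0 -> exists2 x, x \in J1 :|: J2 & sink (J1 :|: J2) x.
Proof.
set J := _ :|: _ => b1 b2 J0.
have [/exists_inP//|/exists_inPn nosink] := boolP [exists x in J, sink J x].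
have succ x : x \in J -> exists2 y, y \in J & O x y.
  move=> /nosink; rewrite negb_forall_in => /exists_inP[y yJ].
  by rewrite negbK; exists y.
pose closed (T : {set S}) := [&& T != set0, T \subset J &
  [forall x in T, forall y in J, O x y ==> (y \in T)]].
have cJ : closed J.
  rewrite /closed J0 subxx /=; apply/forall_inP => x _.
  apply/forall_inP => y ->.
  exact: implybT.
have [T /minsetP[/and3P[T0 TJ Tc] Tmin] _] := minset_exists cJ.
have Tclosed x y : x \in T -> O x y -> y \in J -> y \in T.
  by move=> xT xy yJ; move: (forall_inP (forall_inP Tc x xT) y yJ); rewrite xy.
have Tsucc x : x \in T -> exists2 y, y \in T & O x y.
  move=> xT; have [y yJ xy] := succ x (subsetP TJ x xT).
  by exists y => //; exact: Tclosed xy yJ.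
have Tpred y : y \in T -> exists2 x, x \in T & O x y.
  move=> yT; have [/exists_inP//|/exists_inPn nopred] :=
    boolP [exists x in T, O x y].
  suff E : T :\ y = T by move: yT; rewrite -E !inE eqxx.
  apply: Tmin.
  - have [z zT yz] := Tsucc y yT.
    apply/and3P; split.
    + apply/set0Pn; exists z; rewrite !inE zT andbT.
      by apply: contraTneq yz => ->; exact: orient_irr.
    + by rewrite (subset_trans _ TJ) // subsetDl.
    + apply/forall_inP => a; rewrite !inE => /andP[_ aT].
      apply/forall_inP => b bJ; apply/implyP => ab; rewrite !inE.
      rewrite (Tclosed a b aT ab bJ) andbT.
      by apply: contraTneq ab => ->; exact: nopred.
  - exact: subsetDl.
have [p1 H1] := (belowP w J1).1 b1; have [p2 H2] := (belowP w J2).1 b2.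
have memJ x : (x \in p1) || (x \in p2) = (x \in J).
  by rewrite (ordered_mem H1) (ordered_mem H2) inE.
have U1 := ordered_uniq H1; have U2 := ordered_uniq H2.
case/and3P: H1 => _ C1 w1; case/and3P: H2 => _ C2 w2.
exfalso; apply: (no_cyclic_cover c_dih T0 Tsucc Tpred) U1 C1 w1 U2 C2 w2.
- by move=> x xT; rewrite memJ (subsetP TJ).
- by move=> x y xT xy; rewrite memJ; exact: Tclosed xy.
Qed.

Lemma below_setU w (J1 J2 : {set S}) :
  below w J1 -> below w J2 -> below w (J1 :|: J2).
Proof.
move En : #|J1 :|: J2| => n; elim: n w J1 J2 En => [|n IH] w J1 J2 En b1 b2.
  have : J1 :|: J2 == set0 by rewrite -cards_eq0 En.
  by rewrite setU_eq0 => /andP[/eqP-> /eqP E]; rewrite set0U.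
have [|x xJ sx] := ex_common_sink b1 b2; first by rewrite -cards_eq0 En.
have sub (J : {set S}) : J \subset J1 :|: J2 -> sink J x.
  by move=> /subsetP JJ; apply/forall_inP => y /JJ; exact: (forall_inP sx).
have D : (cox_length g (g x * w)%g < cox_length g w)%N.
  move: xJ; rewrite inE => /orP[x1|x2].
    by have [//] := (below_sink w x1 (sub _ (subsetUl _ _))).1 b1.
  by have [//] := (below_sink w x2 (sub _ (subsetUr _ _))).1 b2.
have down (J : {set S}) :
    J \subset J1 :|: J2 -> below w J -> below (g x * w)%g (J :\ x).
  move=> JJ b; have [xJ'|xJ'] := boolP (x \in J).
    by have [] := (below_sink w xJ' (sub _ JJ)).1 b.
  exact: below_descent.
apply/(below_sink w xJ sx); split=> //; rewrite setDUl; apply: IH.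
- by rewrite -setDUl; move: (cardsD1 x (J1 :|: J2)); rewrite En xJ => -[].
- by apply: down b1; exact: subsetUl.
- by apply: down b2; exact: subsetUr.
Qed.

Lemma below_set0 w : below w set0.
Proof.
apply/belowP; exists [::]; rewrite /ordered_below enum_set0 perm_refl /=.
apply/andP; split; first by apply/forall_inP.
by rewrite /weak_le /word_prod big_nil invg1 mul1g cox_length1.
Qed.

End AcyclicBelow.

Theorem proposition1p7 (W : groupType) (S : finType) (g : coxeter_system W S)
    (w : W) (Omega : orientation (diagram g)) :
  exists! J : {set S},
    acyclic_below Omega w J /\
    (forall J' : {set S},
       acyclic_below Omega w J' -> J \subset J' -> J' = J).
Proof.
pose b J := has (ordered_below Omega w J) (permutations (enum J)).
pose M := \bigcup_(J | b J) J.
have bM : acyclic_below Omega w M.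
  apply: big_ind; first exact: below_set0.
    by move=> J1 J2; exact: below_setU.
  by move=> J /acyclic_belowP.
have sM J : acyclic_below Omega w J -> J \subset M.
  by move/acyclic_belowP => bJ; exact: bigcup_sup.
exists M; split.
  by split=> // J' /sM sJ' sMJ'; apply/eqP; rewrite eqEsubset sJ'.
by move=> J [bJ Jmax]; apply: Jmax => //; exact: sM.
Qed.
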